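(* Let $\Phi=(\varphi_n)_{n\in\mathcal{N}}$ be a doubly transitive equiangular tight frame (DTETF). Then its binder $\operatorname{bin}(\Phi)$ is either empty or forms a BIBD, and in the latter case, any member of the binder $\operatorname{bin}(\Psi)$ of its dual $\Psi$ is an oval of this BIBD.
   Context: Let $\mathbb{F}\in\{\mathbb{R},\mathbb{C}\}$, and let $\Phi=(\varphi_n)_{n\in\mathcal{N}}$ be a finite sequence of vectors in a Hilbert space over $\mathbb{F}$, where $\mathcal{N}$ is a finite nonempty index set. $\Phi$ is equal norm if there is $S>0$ with $\|\varphi_n\|^2=S$ for all $n$. $\Phi$ is a tight frame (for its span) if there is $A>0$ with $\sum_{n}\langle\varphi_n,y\rangle\varphi_n=Ay$ for all $y\in\operatorname{span}(\varphi_n)_{n\in\mathcal{N}}$; equivalently its Gram matrix $\Phi^*\Phi=(\langle\varphi_{n_1},\varphi_{n_2}\rangle)_{n_1,n_2}$ satisfies $(\Phi^*\Phi)^2=A\Phi^*\Phi$. $\Phi$ is equiangular if it is equal norm and there is $C>0$ with $|\langle\varphi_{n_1},\varphi_{n_2}\rangle|^2=C$ whenever $n_1\neq n_2$. An equiangular tight frame (ETF) is an equiangular sequence that is a tight frame (for its span). Dual: a dual (Naimark complement) of a tight frame $\Phi$ with constant $A$ is a sequence $\Psi=(\psi_n)_{n\in\mathcal{N}}$ in a Hilbert space whose Gram matrix is $A\mathbf{I}-\Phi^*\Phi$; it is unique up to unitary transformations of its span. Regular simplex and binder: for $\mathcal{K}\subseteq\mathcal{N}$ nonempty, $(\varphi_n)_{n\in\mathcal{K}}$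 is a regular simplex if it is an ETF whose span has dimension $\#(\mathcal{K})-1$. The binder $\operatorname{bin}(\Phi)$ of an ETF $\Phi$ is the set of all subsets $\mathcal{K}$ of $\mathcal{N}$ for which $(\varphi_n)_{n\in\mathcal{K}}$ is a regular simplex. Symmetries and DTETFs: the symmetry group $\operatorname{Sym}(\Phi)$ of an equal norm $\Phi$ is the group of all permutations $\sigma$ of $\mathcal{N}$ for which there exist unimodular scalars $(z_n)_{n\in\mathcal{N}}$ in $\mathbb{F}$ with $\langle\varphi_{\sigma(n_1)},\varphi_{\sigma(n_2)}\rangle=\overline{z_{n_1}}z_{n_2}\langle\varphi_{n_1},\varphi_{n_2}\rangle$ for all $n_1\neq n_2$. A DTETF is an equal norm finite sequence $\Phi$ with $\dim(\operatorname{span}(\varphi_n)_{n\in\mathcal{N}})<\#(\mathcal{N})$ such that the natural action of $\operatorname{Sym}(\Phi)$ on $\mathcal{N}$ is doubly transitive (for all $n_1\ne n_2$ and $n_3\neq n_4$ some $\sigma\in\operatorname{Sym}(\Phi)$ has $\sigma(n_1)=n_3$, $\sigma(n_2)=n_4$). It is known that any such $\Phi$ is an ETF. BIBDs: a BIBD $(\mathcal{V},(\mathcal{K}_b)_{b\in\mathcal{B}})$ consists of a finite vertex set $\mathcal{V}$ and a finite (nonempty) sequence of subsets (blocks) of $\mathcal{V}$, all of the same size $K\geq2$, such that for some integer $\Lambda$ any two distinct vertices are contained together in exactly $\Lambda$ blocks. We say $\operatorname{bin}(\Phi)$ forms a BIBD if $(\mathcal{N},(\mathcal{K}_b)_{b\in\mathcal{B}})$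 is a BIBD for some enumeration (bijection) $b\mapsto\mathcal{K}_b$ of $\operatorname{bin}(\Phi)$. An oval of a BIBD is a nonempty subset $\mathcal{L}\subseteq\mathcal{V}$ with $\#(\mathcal{K}_b\cap\mathcal{L})\in\{0,2\}$ for all $b\in\mathcal{B}$ (equivalently, $\#(\mathcal{K}_b\cap\mathcal{L})\leq2$ for all $b$ and $\#(\mathcal{L})=\frac{\#(\mathcal{V})-1}{K-1}+1$). *)

(* Defs.v *)
From mathcomp Require Import all_boot all_order all_algebra all_fingroup.
From mathcomp Require Import all_classical all_reals all_analysis.
From mathcomp Require Import sesquilinear complex.

Set Implicit Arguments.
Unset Strict Implicit.
Unset Printing Implicit Defensive.

Import Order.TTheory GRing.Theory Num.Theory.
Import numFieldNormedType.Exports.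

Local Open Scope ring_scope.

Variant scalar_kind := RealScalars | ComplexScalars.

Definition scalars (R : realType) (k : scalar_kind) : numFieldType :=
  match k with
  | RealScalars => R
  | ComplexScalars => R[i]%C
  end.

Definition conj (R : realType) (k : scalar_kind) :
    scalars R k -> scalars R k :=
  match k with
  | RealScalars => idfun
  | ComplexScalars => @Num.conj R[i]%C
  end.

Record hilbertSpace (R : realType) (k : scalar_kind) := HilbertSpace {
  hilbert_sort :> completeNormedModType (scalars R k);
  hilbert_dot : {dot hilbert_sort for @conj R k};
  hilbert_normE : forall x, `|x| ^+ 2 = hilbert_dot x x }.

(* A form of type {dot V for _} is linear in its first argument, whereas
   <x, y> below is conjugate-linear in x and linear in y. *)
Definition inner (R : realType) (k : scalar_kind) (V : hilbertSpace R k)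
  (x y : V) : scalars R k := hilbert_dot V y x.

Section Frames.
Variables (R : realType) (k : scalar_kind) (V : hilbertSpace R k).
Local Notation F := (scalars R k).

Section Sequence.
Variables (I : finType) (phi : I -> V).

Definition gram (i j : I) : F := inner (phi i) (phi j).

Definition seq_span : set V :=
  [set v | exists c : I -> F, v = \sum_i c i *: phi i]%classic.

Definition lin_indep : Prop :=
  forall c : I -> F, \sum_i c i *: phi i = 0 -> forall i, c i = 0.

Definition equal_norm : Prop :=
  exists2 S : F, 0 < S & forall i, `|phi i| ^+ 2 = S.

Definition tight_constant (A : F) : Prop :=
  0 < A /\
  forall y, seq_span y -> \sum_i inner (phi i) y *: phi i = A *: y.

Definition tight_frame : Prop := exists A : F, tight_constant A.

Definition equiangular : Prop :=
  equal_norm /\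
  exists2 C : F, 0 < C & forall i j, i != j -> `|gram i j| ^+ 2 = C.

Definition etf : Prop := equiangular /\ tight_frame.

Definition symmetry : set {perm I} :=
  [set s : {perm I} | exists z : I -> F, (forall i, `|z i| = 1) /\
     forall i j, i != j ->
       gram (s i) (s j) = conj (z i) * z j * gram i j]%classic.

End Sequence.

Definition span_dim (I : finType) (phi : I -> V) (d : nat) : Prop :=
  exists b : 'I_d -> V, lin_indep b /\ seq_span b = seq_span phi.

Definition regular_simplex (I : finType) (phi : I -> V) : Prop :=
  etf phi /\ span_dim phi #|I|.-1.

Definition subsequence (N : finType) (phi : N -> V) (K : {set N}) :
  {n : N | n \in K} -> V := fun n => phi (val n).

Definition binder (N : finType) (phi : N -> V) : set {set N} :=
  [set K : {set N} | (0 < #|K|)%N /\ regular_simplex (subsequence phi (K := K))]%classic.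

Definition dtetf (N : finType) (phi : N -> V) : Prop :=
  [/\ equal_norm phi,
      exists2 d, span_dim phi d & (d < #|N|)%N
    & forall n1 n2 n3 n4 : N, n1 != n2 -> n3 != n4 ->
        exists2 s, symmetry phi s & s n1 = n3 /\ s n2 = n4].

End Frames.

Definition dual (R : realType) (k : scalar_kind) (V W : hilbertSpace R k)
    (N : finType) (phi : N -> V) (psi : N -> W) : Prop :=
  exists2 A : scalars R k, tight_constant phi A &
    forall n1 n2, gram psi n1 n2 = A *+ (n1 == n2) - gram phi n1 n2.

Section Designs.
Variables (N B : finType) (blk : B -> {set N}).

Definition bibd : Prop :=
  (0 < #|B|)%N /\
  exists K L : nat, [/\ (2 <= K)%N,
    forall b, #|blk b| = K
  & forall v w, v != w ->
      #|[set b | (v \in blk b) && (w \in blk b)]%SET| = L].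

Definition oval (L : {set N}) : Prop :=
  (0 < #|L|)%N /\ forall b, #|blk b :&: L| = 0%N \/ #|blk b :&: L| = 2%N.

Definition enumerates (C : set {set N}) : Prop :=
  set_bij [set: B]%classic C blk.

End Designs.

Definition forms_bibd (N : finType) (C : set {set N}) : Prop :=
  exists (B : finType) (blk : B -> {set N}), enumerates blk C /\ bibd blk.

(* Main.v *)
(* A sequence of n > 1 vectors is a regular simplex exactly when its Gram matrix
   is t (n I - u u^H) for some t > 0 and some unimodular vector u, which then
   spans the kernel.  Double transitivity forces the moduli of all off-diagonal
   Gram entries to agree, so t and hence n = |phi_i|^2 / t + 1 are common to all
   simplices; Sym(phi) permutes the binder and is transitive on pairs, whence
   the BIBD.  If K is a simplex of phi with kernel vector u, and L one of the
   dual with kernel vector w, put a_i = conj(u_i) w_i for i in K :&: L.  Since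
   u and w are eigenvectors of the Gram matrix of phi for the eigenvalues 0 and
   A, the a_i sum to 0; since the off-diagonal Gram entries of phi and of its
   dual are opposite, a_i = - a_j for i != j.  So K :&: L has 0 or 2 elements. *)
Require Import Defs.
From mathcomp Require Import all_boot all_order all_algebra all_fingroup.
From mathcomp Require Import all_classical all_reals all_analysis.
From HB Require Import structures.
From mathcomp Require Import sesquilinear complex ring.

Set Implicit Arguments.
Unset Strict Implicit.
Unset Printing Implicit Defensive.

Import Order.TTheory GRing.Theory Num.Theory.

Local Open Scope ring_scope.

(** * Conjugation on the scalar field, real and complex alike *)

Section Conjugation.
Variables (R : realType) (k : scalar_kind).
Implicit Types x : scalars R k.

Fact conj_is_zmod_morphism : zmod_morphism (@conj R k).
Proof. by case: k => //=; apply: rmorphB. Qed.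

Fact conj_is_monoid_morphism : monoid_morphism (@conj R k).
Proof. by case: k => //=; split; [apply: rmorph1 | apply: rmorphM]. Qed.

HB.instance Definition _ := GRing.isZmodMorphism.Build _ _ (@conj R k)
  conj_is_zmod_morphism.
HB.instance Definition _ := GRing.isMonoidMorphism.Build _ _ (@conj R k)
  conj_is_monoid_morphism.

Lemma scalar_conjK : involutive (@conj R k).
Proof. by case: k => //=; apply: conjCK. Qed.

Lemma sqr_norm_conj x : `|x| ^+ 2 = x * conj x.
Proof.
by case: k x => /= x; [rewrite real_normK ?num_real ?expr2 | apply: normCK].
Qed.

Lemma norm_conj x : `|conj x| = `|x|.
Proof. by case: k x => /= x //; apply: norm_conjC. Qed.

Lemma conj_ge0 x : 0 <= x -> conj x = x.
Proof. by case: k x => /= x //; apply: geC0_conj. Qed.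

Lemma unimodular_mul_conj x : `|x| = 1 -> x * conj x = 1.
Proof. by rewrite -sqr_norm_conj => ->; rewrite expr1n. Qed.

End Conjugation.

(** * Rules for the inner product *)

Section InnerProduct.
Variables (R : realType) (k : scalar_kind) (V : hilbertSpace R k).
Implicit Types x y : V.

Lemma inner_sumZr (I : finType) x (c : I -> scalars R k) (v : I -> V) :
  inner x (\sum_i c i *: v i) = \sum_i c i * inner x (v i).
Proof.
by rewrite /inner linear_sumlz; apply: eq_bigr => i _; rewrite linearZl_LR.
Qed.

Lemma innerZr x a y : inner x (a *: y) = a * inner x y.
Proof. by rewrite /inner linearZl_LR. Qed.

Lemma inner_conj x y : inner x y = conj (inner y x).
Proof. by rewrite /inner hermC expr0 mul1r. Qed.

Lemma sqr_norm_inner x : `|x| ^+ 2 = inner x x.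
Proof. exact: hilbert_normE. Qed.

End InnerProduct.

(* The hypotheses make sum_j |Q i j * Q j l - t * Q i l|^2 vanish; the conclusion
   says that Q has rank one. *)
Lemma constant_modulus_idempotent (R : realType) (k : scalar_kind) (I : finType)
    (t : scalars R k) (Q : I -> I -> scalars R k) :
    (forall i j, `|Q i j| = t) ->
    (forall i l, \sum_j Q i j * Q j l = t *+ #|I| * Q i l) ->
  forall i j l, Q i j * Q j l = t * Q i l.
Proof.
move=> Qt QQ i j l.
have t_conj : conj t = t by rewrite conj_ge0 // -(Qt i i).
apply/eqP; rewrite -subr_eq0 -normr_eq0 -sqrf_eq0; apply/eqP; move: j isT.
apply: psumr_eq0P => [j _|]; first by rewrite exprn_ge0.
(* All moduli being known, the square is 2 t^4 minus two cross terms; by [QQ], each of these sums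
   over [j] to t^4 times [#|I|]. *)
have termE j : `|Q i j * Q j l - t * Q i l| ^+ 2 =
    t ^+ 4 *+ 2 - Q i j * Q j l * (t * conj (Q i l))
      - conj (Q i j * Q j l) * (t * Q i l).
  have QQt : Q i j * Q j l * conj (Q i j * Q j l) = t ^+ 4.
    by rewrite -sqr_norm_conj normrM !Qt -expr2 -exprM.
  have tQt : t * Q i l * (t * conj (Q i l)) = t ^+ 4.
    by rewrite mulrACA -sqr_norm_conj Qt -expr2 -exprD.
  have conjtQ : conj (t * Q i l) = t * conj (Q i l) by rewrite rmorphM /= t_conj.
  rewrite sqr_norm_conj rmorphB /= conjtQ mulrBl !mulrBr QQt tQt; ring.
rewrite (eq_bigr _ (fun j _ => termE j)) !big_split /= !sumrN -!mulr_suml.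
rewrite -rmorph_sum QQ rmorphM rmorphMn /= t_conj.
have Qn : Q i l * conj (Q i l) = t ^+ 2 by rewrite -sqr_norm_conj Qt.
rewrite sumr_const.
have -> : t *+ #|I| * Q i l * (t * conj (Q i l)) = t ^+ 4 *+ #|I|.
  by rewrite mulrACA Qn !mulrnAl; congr (_ *+ _); ring.
have -> : t *+ #|I| * conj (Q i l) * (t * Q i l) = t ^+ 4 *+ #|I|.
  by rewrite mulrACA [conj _ * _]mulrC Qn !mulrnAl; congr (_ *+ _); ring.
by rewrite mulrnAl -[t * (t * _)]/(t ^+ 4) addrK subrr.
Qed.

Lemma seq_span_mem (R : realType) (k : scalar_kind) (V : hilbertSpace R k)
  (I : finType) (phi : I -> V) i : seq_span phi (phi i).
Proof.
exists (fun j => (j == i)%:R); rewrite (bigD1 i) //= eqxx scale1r.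
by rewrite big1 ?addr0 // => j /negbTE ->; rewrite scale0r.
Qed.

(** * Gram matrices of tight frames and of regular simplices *)

Section Gram.
Variables (R : realType) (k : scalar_kind) (V : hilbertSpace R k).
Variables (I : finType) (phi : I -> V).
Local Notation F := (scalars R k).

Lemma gram_diag i : gram phi i i = `|phi i| ^+ 2.
Proof. by rewrite sqr_norm_inner. Qed.

Lemma gram_conj i j : conj (gram phi i j) = gram phi j i.
Proof. by rewrite /gram -inner_conj. Qed.

Lemma gram_tight (A : F) : tight_constant phi A ->
  forall i l, \sum_j gram phi i j * gram phi j l = A * gram phi i l.
Proof.
move=> [_ /(_ _ (seq_span_mem _ _)) phiA] i l.
rewrite /gram -innerZr -phiA inner_sumZr.
by apply: eq_bigr => j _; rewrite mulrC.
Qed.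

(* Both sides are the trace of the frame operator on the span of phi. *)
Lemma trace_gram_tight (A : F) (d : nat) :
    tight_constant phi A -> span_dim phi d ->
  \sum_i gram phi i i = A *+ d.
Proof.
move=> [_ phiA] [b [b_indep b_span]].
have /boolp.choice[X phiE] : forall i, exists c : 'I_d -> F,
    phi i = \sum_l c l *: b l.
  by move=> i; have := seq_span_mem phi i; rewrite -b_span.
have b_mem l : seq_span phi (b l) by rewrite -b_span; apply: seq_span_mem.
(* The sum is the [l]-th coordinate, in the basis [b], of the frame operator applied to [b n], which
   tightness makes [A *: b n]. *)
have matrixA n : forall l,
    \sum_i X i l * inner (phi i) (b n) - A * (l == n)%:R = 0.
  apply: b_indep; under eq_bigr do rewrite scalerBl scaler_suml.
  rewrite sumrB exchange_big /=; apply/eqP; rewrite subr_eq0; apply/eqP.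
  transitivity (A *: b n).
    rewrite -phiA //; apply: eq_bigr => i _; rewrite {3}phiE scaler_sumr.
    by apply: eq_bigr => l _; rewrite scalerA mulrC.
  rewrite (bigD1 n) //= eqxx mulr1 big1 ?addr0 // => l /negbTE ->.
  by rewrite mulr0 scale0r.
transitivity (\sum_i \sum_l X i l * inner (phi i) (b l)).
  by apply: eq_bigr => i _; rewrite /gram {2}phiE inner_sumZr.
rewrite exchange_big /= -[in RHS](card_ord d) -sumr_const; apply: eq_bigr => l _.
by apply/eqP; have := matrixA l l; rewrite eqxx mulr1 => /eqP; rewrite subr_eq0.
Qed.

(** The matrix is [t *+ #|I|] times the orthogonal projection onto the complement of [u]. *)
Definition simplex_gram (t : F) (u : I -> F) : Prop :=
  [/\ 0 < t, forall i, `|u i| = 1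
    & forall i j, gram phi i j = t *+ #|I| *+ (i == j) - t * u i * conj (u j)].

(** The squared norm of the sum is u^H G u, where G is the Gram matrix, and G u = 0. *)
Lemma sum_simplex_gram t u : simplex_gram t u -> \sum_i u i *: phi i = 0.
Proof.
move=> [t_gt0 u1 gramE]; apply/eqP; rewrite -normr_eq0 -sqrf_eq0; apply/eqP.
rewrite sqr_norm_inner inner_sumZr big1 // => i _; rewrite inner_conj inner_sumZr.
suff -> : \sum_j u j * inner (phi i) (phi j) = 0 by rewrite rmorph0 mulr0.
transitivity (\sum_j (t *+ #|I| *+ (i == j) * u j - t * u i)).
  apply: eq_bigr => j _; rewrite -[inner (phi _) _]/(gram phi i j) gramE.
  rewrite mulrBr [u j * _]mulrC; congr (_ - _).
  by rewrite mulrCA unimodular_mul_conj ?mulr1.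
rewrite sumrB (bigD1 i) //= eqxx mulr1n big1 => [|j /negbTE].
  by rewrite addr0 sumr_const mulrnAl subrr.
by rewrite eq_sym => ->; rewrite mul0r.
Qed.

(** The trace and one diagonal entry of G^2 = A G determine A, S and C from t = A - S. Then Q = A I
    - G has all entries of modulus t and Q^2 = A Q, hence rank one. *)
Lemma regular_simplex_gram : (0 < #|I|)%N -> regular_simplex phi ->
  (1 < #|I|)%N /\ exists t u, simplex_gram t u.
Proof.
move=> I_gt0 [[[[S S_gt0 normS] [C C_gt0 offC]] [A tightA]] dim_phi].
have diagS i : gram phi i i = S by rewrite gram_diag normS.
have trE := trace_gram_tight tightA dim_phi.
have A_gt0 : 0 < A by case: tightA.
have {}trE : S *+ #|I| = A *+ #|I|.-1.
  by rewrite -trE (eq_bigr _ (fun i _ => diagS i)) sumr_const.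
(* For a single vector [trE] would read S = 0. *)
have I_gt1 : (1 < #|I|)%N.
  move: I_gt0 trE; case: #|I| => [|[|m]] //= _ /eqP.
  by rewrite mulr0n mulr1n gt_eqF.
split=> //; have [i0 _] : exists i : I, i \in I by apply/card_gt0P.
pose t := A - S.
have nt : t *+ #|I| = A.
  by rewrite mulrnBl trE -mulrnBr ?leq_pred // -subn1 subKn ?mulr1n.
have t_gt0 : 0 < t by rewrite -(pmulrn_lgt0 _ I_gt0) nt.
have SE : S = t *+ #|I|.-1.
  by apply: (addrI t); rewrite -mulrS prednK // nt /t subrK.
(* This is the diagonal entry of G^2 = A G at [i0]. *)
have rowE : S * S + C *+ #|I|.-1 = A * S.
  rewrite -{3}(diagS i0) -(gram_tight tightA) (bigD1 i0) //= diagS; congr (_ + _).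
  rewrite -(cardC1 i0) -sumr_const; apply: eq_big => [j|j]; first by rewrite inE.
  by rewrite inE => j_i; rewrite -[gram phi j i0]gram_conj -sqr_norm_conj offC //
    eq_sym.
have CE : C = t ^+ 2.
  have : C *+ #|I|.-1 = t ^+ 2 *+ #|I|.-1.
    apply: (addrI (S * S)); rewrite rowE.
    by rewrite expr2 -mulrnAr -SE /t mulrBl addrC subrK.
  by move/(pmulrnI _); apply; rewrite -subn1 subn_gt0.
pose Q i j := A *+ (i == j) - gram phi i j.
have Qt i j : `|Q i j| = t.
  rewrite /Q; have [->|i_j] := eqVneq i j.
    by rewrite mulr1n diagS ger0_norm // ltW.
  rewrite mulr0n sub0r normrN; apply/eqP.
  by rewrite -(@eqrXn2 _ 2) ?(ltW t_gt0) // offC // CE.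
have QQ i l : \sum_j Q i j * Q j l = t *+ #|I| * Q i l.
  rewrite nt (eq_bigr (fun j => (A * Q i l *+ (i == j) - A * gram phi i j *+ (j == l))
    + gram phi i j * gram phi j l)); last first.
    move=> j _; rewrite /Q; have [->|_] := eqVneq i j; have [->|_] := eqVneq j l;
      rewrite ?mulr1n ?mulr0n; ring.
  rewrite big_split sumrB /= (gram_tight tightA) (bigD1 i) //= eqxx mulr1n.
  rewrite big1 ?addr0 => [|j /negbTE]; last by rewrite eq_sym => ->.
  rewrite (bigD1 l) //= eqxx mulr1n big1 ?addr0 => [|j /negbTE -> //].
  by rewrite subrK.
have Q_conj i j : conj (Q i j) = Q j i.
  rewrite rmorphB rmorphMn /= gram_conj conj_ge0 ?(ltW A_gt0) //.
  by rewrite /Q eq_sym.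
(* The vector is a column of the rank-one matrix Q, scaled to be unimodular. *)
exists t, (fun i => Q i i0 / t); split=> // [i|i j].
  by rewrite normrM normfV Qt ger0_norm ?(ltW t_gt0) // divff ?gt_eqF.
rewrite rmorphM fmorphV /= Q_conj (conj_ge0 (ltW t_gt0)) nt.
apply/eqP; rewrite eq_sym subr_eq addrC -subr_eq eq_sym; apply/eqP.
have t_neq0 : t != 0 by rewrite gt_eqF.
have QQt := constant_modulus_idempotent Qt QQ i i0 j.
have -> : t * (Q i i0 / t) * (Q i0 j / t) = Q i i0 * Q i0 j / t.
  by rewrite [t * (_ / t)]mulrCA divff // mulr1 mulrA.
by rewrite QQt mulrC mulKf.
Qed.

Lemma simplex_gram_regular t u : (1 < #|I|)%N -> simplex_gram t u ->
  regular_simplex phi.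
Proof.
move=> I_gt1 t_u; have [t_gt0 u1 gramE] := t_u.
have sum0 := sum_simplex_gram t_u.
have t_neq0 : t != 0 by rewrite gt_eqF.
have u_neq0 i : u i != 0 by rewrite -normr_eq0 u1 oner_eq0.
have I_gt0 : (0 < #|I|)%N by apply: ltnW.
have [i0 _] : exists i : I, i \in I by apply/card_gt0P.
split; first split; first split.
- exists (t *+ #|I| - t) => [|i].
    by rewrite subr_gt0 -[ltLHS]mulr1n ltr_pMn2l.
  by rewrite -gram_diag gramE eqxx mulr1n -mulrA unimodular_mul_conj // mulr1.
- exists (t ^+ 2) => [|i j /negbTE i_j]; first by rewrite exprn_gt0.
  rewrite gramE i_j mulr0n sub0r normrN !normrM norm_conj !u1 !mulr1.
  by rewrite ger0_norm // ltW.
- exists (t *+ #|I|); split=> [|y [c ->]]; first by rewrite pmulrn_lgt0.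
  under eq_bigr do rewrite inner_sumZr scaler_suml.
  rewrite exchange_big scaler_sumr; apply: eq_bigr => j _ /=.
  (* The rank-one part of the Gram matrix only contributes a multiple of the vanishing sum in
     [sum0]. *)
  rewrite (eq_bigr (fun i => (c j * t *+ #|I| *+ (i == j)) *: phi i -
     (c j * t * conj (u j)) *: (u i *: phi i))); last first.
    move=> i _; rewrite -[inner (phi _) _]/(gram phi i j) gramE.
    by rewrite mulrBr scalerBl scalerA !mulrnAr !mulrA; congr (_ - _ *: _); ring.
  rewrite sumrB -scaler_sumr sum0 scaler0 subr0 (bigD1 j) //= eqxx mulr1n.
  rewrite big1 ?addr0 => [|i /negbTE ->]; last by rewrite mulr0n scale0r.
  by rewrite scalerA mulrC mulrnAl mulrC -mulrnAl.
(* Any relation among the phi i is proportional to u, so dropping one vector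
   leaves a basis. *)
have relation (c : I -> F) : \sum_i c i *: phi i = 0 -> c i0 = 0 ->
    forall i, c i = 0.
  move=> c_rel c0; pose s := \sum_j conj (u j) * c j.
  (* Pair the relation with [phi i]. At [i0] this forces s = 0, and then every coefficient
     vanishes. *)
  have cE i : t *+ #|I| * c i = t * s * u i.
    apply/eqP; rewrite -subr_eq0.
    have <- : inner (phi i) (\sum_j c j *: phi j) = t *+ #|I| * c i - t * s * u i.
      rewrite inner_sumZr (eq_bigr (fun j => t *+ #|I| * c j *+ (i == j) -
        t * u i * (conj (u j) * c j))); last first.
        move=> j _; rewrite -[inner (phi _) _]/(gram phi i j) gramE.
        by case: eqP => _; rewrite ?mulr1n ?mulr0n; ring.
      rewrite sumrB -mulr_sumr (bigD1 i) //= eqxx mulr1n big1 ?addr0.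
        by rewrite mulrAC.
      by move=> j /negbTE; rewrite eq_sym => ->.
    by rewrite c_rel /inner linear0l.
  have s0 : s = 0.
    have := cE i0; rewrite c0 mulr0 => /esym/eqP.
    by rewrite !mulf_eq0 (negbTE t_neq0) (negbTE (u_neq0 _)) orbF => /eqP.
  move=> i; have := cE i; rewrite s0 mulr0 mul0r => /eqP.
  by rewrite mulf_eq0 mulrn_eq0 -leqn0 leqNgt I_gt0 (negbTE t_neq0) => /eqP.
pose D := predC1 i0.
have cardD : #|D| = #|I|.-1 by rewrite cardC1.
rewrite -cardD; exists (fun m => phi (enum_val m)).
have sumD (c : I -> F) : \sum_(m < #|D|) c (enum_val m) *: phi (enum_val m) =
    \sum_(i in D) c i *: phi i by rewrite [RHS]big_enum_val.
have lift_coef (c : 'I_#|D| -> F) : exists2 c' : I -> F, c' i0 = 0 &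
    forall m, c m = c' (enum_val m).
  exists (fun i => \sum_(m | enum_val m == i) c m) => [|m].
    by rewrite big1 // => m /eqP m_i0; have := enum_valP m; rewrite m_i0 inE eqxx.
  rewrite (big_pred1 m) // => m'; exact: (inj_eq enum_val_inj).
have sumD0 (c : I -> F) : c i0 = 0 ->
    \sum_(i in D) c i *: phi i = \sum_i c i *: phi i.
  by move=> c0; rewrite [RHS](bigD1 i0) //= c0 scale0r add0r.
split=> [c|].
  have [c' c'0 cE] := lift_coef c.
  under eq_bigr do rewrite cE.
  by rewrite sumD sumD0 // => c'_rel m; rewrite cE (relation c').
rewrite predeqE => v; split=> [[c ->]|[c ->]].
  have [c' c'0 cE] := lift_coef c.
  by exists c'; under eq_bigr do rewrite cE; rewrite sumD sumD0.
(* Subtracting this multiple of the relation [sum0] keeps the vector and clears the coefficient at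
   [i0]. *)
pose c' i := c i - c i0 / u i0 * u i.
exists (fun m => c' (enum_val m)); rewrite sumD sumD0; last first.
  by rewrite /c' divfK // subrr.
under [RHS]eq_bigr do rewrite scalerBl -scalerA.
by rewrite sumrB -scaler_sumr sum0 scaler0 subr0.
Qed.

End Gram.

(** * The binder, its symmetries and the block design *)

Section Binder.
Variables (R : realType) (k : scalar_kind) (V : hilbertSpace R k).
Variables (N : finType) (phi : N -> V).
Local Notation F := (scalars R k).
Implicit Types K : {set N}.

(** Taking [u] on all of [N], constrained only on [K], lets [K] be permuted or intersected without
    changing types. *)
Definition simplex_gram_on K (t : F) (u : N -> F) : Prop :=
  [/\ 0 < t, forall n, n \in K -> `|u n| = 1
    & {in K &, forall m n,
        gram phi m n = t *+ #|K| *+ (m == n) - t * u m * conj (u n)}].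

Lemma card_set_sig K : #|{: {n : N | n \in K}}| = #|K|.
Proof. by rewrite card_sig; apply: eq_card => n; rewrite inE. Qed.

Lemma simplex_gram_sub K t u : simplex_gram_on K t u ->
  simplex_gram (subsequence phi (K := K)) t (fun n => u (val n)).
Proof.
move=> [t_gt0 u1 gramE]; split=> // [n|m n]; first exact: u1 (valP n).
by rewrite card_set_sig -(inj_eq val_inj); apply: gramE; apply: valP.
Qed.

Lemma sum_simplex_gram_on K t u :
  simplex_gram_on K t u -> \sum_(n in K) u n *: phi n = 0.
Proof. by rewrite big_sub => /simplex_gram_sub/sum_simplex_gram. Qed.

Lemma binder_simplex_gram K : binder phi K <->
  (1 < #|K|)%N /\ exists t u, simplex_gram_on K t u.
Proof.
split=> [[K_gt0 /regular_simplex_gram]|[K_gt1 [t [u t_u]]]].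
  rewrite card_set_sig => /(_ K_gt0)[K_gt1 [t [u [t_gt0 u1 gramE]]]].
  (* The value 1 outside [K] is arbitrary. *)
  split=> //; exists t, (fun n => if insub n is Some m then u m else 1).
  split=> // [n nK|m n mK nK]; first by rewrite insubT u1.
  rewrite !insubT; have := gramE (Sub m mK) (Sub n nK).
  by rewrite card_set_sig -(inj_eq val_inj) !SubK.
split; first exact: ltnW.
by apply: simplex_gram_regular (simplex_gram_sub t_u); rewrite card_set_sig.
Qed.

Lemma simplex_gram_on_diag K t u n : simplex_gram_on K t u -> n \in K ->
  gram phi n n = t *+ #|K| - t.
Proof.
move=> [_ u1 gramE] nK.
by rewrite gramE // eqxx mulr1n -mulrA unimodular_mul_conj ?u1 // mulr1.
Qed.

Lemma simplex_gram_on_norm K t u m n : simplex_gram_on K t u ->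
  m \in K -> n \in K -> m != n -> `|gram phi m n| = t.
Proof.
move=> [t_gt0 u1 gramE] mK nK /negbTE m_n; rewrite gramE // m_n mulr0n sub0r.
by rewrite normrN !normrM norm_conj !u1 // !mulr1 ger0_norm // ltW.
Qed.

Lemma binder_card K K' :
    equal_norm phi ->
    (forall m n m' n', m != n -> m' != n' -> `|gram phi m n| = `|gram phi m' n'|) ->
  binder phi K -> binder phi K' -> #|K| = #|K'|.
Proof.
move=> [S _ normS] gram_const.
move=> /binder_simplex_gram[/card_gt1P[m [n [mK nK m_n]]] [t [u t_u]]].
move=> /binder_simplex_gram[/card_gt1P[m' [n' [mK' nK' m_n']]] [t' [u' t_u']]].
have tt' : t = t'.
  rewrite -(simplex_gram_on_norm t_u mK nK m_n) (gram_const _ _ _ _ m_n m_n').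
  exact: simplex_gram_on_norm t_u' mK' nK' m_n'.
have t_neq0 : t != 0 by rewrite gt_eqF //; case: t_u.
(* Both t ([#|K|] - 1) and t ([#|K'|] - 1) are the common squared norm. *)
apply: (mulrIn t_neq0); apply: (addIr (- t)).
rewrite -(simplex_gram_on_diag t_u mK) [in RHS]tt' -(simplex_gram_on_diag t_u' mK').
by rewrite !gram_diag !normS.
Qed.

(** The scalars of the symmetry are absorbed into the kernel vector, with the same [t]. They govern
    only off-diagonal entries; equal norm settles the diagonal. *)
Lemma symmetry_binder (s : {perm N}) K :
  equal_norm phi -> symmetry phi s -> binder phi K -> binder phi (s @: K).
Proof.
move=> [S _ normS] [z [z1 gram_s]].
move=> /binder_simplex_gram[K_gt1 [t [u t_u]]].
have [t_gt0 u1 gramE] := t_u.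
have cardK : #|s @: K| = #|K| by rewrite card_imset //; apply: perm_inj.
apply/binder_simplex_gram; rewrite cardK; split=> //.
exists t, (fun n => conj (z (s^-1%g n)) * u (s^-1%g n)).
split=> // [_ /imsetP[n nK ->]|_ _ /imsetP[m mK ->] /imsetP[n nK ->]].
  by rewrite permK normrM norm_conj z1 u1 // mulr1.
rewrite !permK cardK (inj_eq perm_inj); have [<-|m_n] := eqVneq m n.
  rewrite gram_diag normS -(normS m) -gram_diag gramE // eqxx; congr (_ - _).
  rewrite -mulrA unimodular_mul_conj ?u1 // mulr1.
  rewrite -mulrA unimodular_mul_conj ?mulr1 //.
  by rewrite normrM norm_conj z1 u1 // mulr1.
rewrite gram_s // gramE // (negbTE m_n) !mulr0n !sub0r rmorphM /= scalar_conjK.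
ring.
Qed.

Lemma symmetry_norm_gram (s : {perm N}) m n :
  symmetry phi s -> m != n -> `|gram phi (s m) (s n)| = `|gram phi m n|.
Proof.
move=> [z [z1 gram_s]] m_n.
by rewrite gram_s // !normrM norm_conj !z1 !mul1r.
Qed.

Lemma dtetf_binder_bibd : dtetf phi ->
  binder phi = classical_sets.set0 \/ forms_bibd (binder phi).
Proof.
move=> [eq_norm _ two_trans].
have [->|/classical_sets.set0P[K0 K0_bin]] :=
  eqVneq (binder phi) classical_sets.set0; first by left.
right; pose B := {K : {set N} | `[< binder phi K >]}.
have blk_bin (b : B) : binder phi (val b) by apply: asboolW (valP b).
exists B, val; split; first split=> [b _|b c _ _|K K_bin].
- exact: blk_bin.
- exact: val_inj.
- by exists (Sub K (asboolT K_bin)); rewrite ?SubK.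
have gram_const m n m' n' : m != n -> m' != n' ->
    `|gram phi m n| = `|gram phi m' n'|.
  move=> m_n m_n'; have [s s_sym [<- <-]] := two_trans _ _ _ _ m_n m_n'.
  by rewrite symmetry_norm_gram.
pose b0 : B := Sub K0 (asboolT K0_bin).
split; first by apply/card_gt0P; exists b0.
have [K0_gt1 _] := (binder_simplex_gram K0).1 K0_bin.
have [v0 [w0 [_ _ v_w0]]] := card_gt1P K0_gt1.
pose through v w := [set b : B | (v \in val b) && (w \in val b)]%SET.
exists #|K0|, #|through v0 w0|; split=> // [b|v w v_w].
  exact: binder_card eq_norm gram_const (blk_bin b) K0_bin.
(* A symmetry taking the first pair to the second maps the blocks through the one injectively to
   blocks through the other. *)
suff le_through v1 w1 v2 w2 : v1 != w1 -> v2 != w2 ->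
    (#|through v1 w1| <= #|through v2 w2|)%N.
  by apply/eqP; rewrite eqn_leq !le_through.
move=> v_w1 v_w2; have [s s_sym [sv sw]] := two_trans _ _ _ _ v_w1 v_w2.
pose image (b : B) : B :=
  Sub (s @: val b) (asboolT (symmetry_binder eq_norm s_sym (blk_bin b))).
have image_inj : injective image.
  by move=> b c /(congr1 val) /(imset_inj perm_inj)/val_inj.
rewrite -(card_imset _ image_inj); apply/subset_leq_card/fintype.subsetP => c.
move=> /imsetP[b]; rewrite !inE => /andP[v_b w_b] ->.
by rewrite SubK -sv -sw !imset_f.
Qed.

End Binder.

(** * Simplices of a frame against simplices of its dual *)

Lemma binder_dual_inter (R : realType) (k : scalar_kind)
    (V W : hilbertSpace R k) (N : finType) (phi : N -> V) (psi : N -> W)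
    (K L : {set N}) :
    dual phi psi -> binder phi K -> binder psi L ->
  #|K :&: L| = 0%N \/ #|K :&: L| = 2%N.
Proof.
move=> [A [A_gt0 _] psiE] /binder_simplex_gram[_ [t [u t_u]]].
move=> /binder_simplex_gram[_ [t' [w t_w]]].
have [t_gt0 u1 phi_gram] := t_u; have [_ w1 psi_gram] := t_w.
pose a n := conj (u n) * w n.
have a_neq0 n : n \in K :&: L -> a n != 0.
  move=> /setIP[nK nL].
  by rewrite -normr_eq0 normrM norm_conj u1 // w1 // mulr1 oner_eq0.
have sum_a : \sum_(n in K :&: L) a n = 0.
  (* The Gram matrix of [psi] kills [w] extended by zero off [L], so that of [phi] multiplies it by
     [A]. *)
  have rowL m : \sum_(n in L) w n * gram phi m n = A * w m *+ (m \in L).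
    have psi0 : \sum_(n in L) w n * gram psi m n = 0.
      rewrite -[RHS](_ : inner (psi m) 0 = 0); last by rewrite /inner linear0l.
      rewrite -(sum_simplex_gram_on t_w) /inner linear_sumlz.
      by apply: eq_bigr => n _; rewrite linearZl_LR.
    rewrite -[LHS]addr0 -[X in _ + X]psi0 -big_split /=.
    rewrite (eq_bigr (fun n => A * w n *+ (m == n))) => [|n _]; last first.
      by rewrite psiE mulrBr addrC subrK mulrnAr mulrC.
    have [mL|mL] := boolP (m \in L).
      rewrite (bigD1 m) //= eqxx big1 ?addr0 // => n /andP[_ /negbTE].
      by rewrite eq_sym => ->.
    rewrite big1 // => n nL; case: eqP nL mL => // <- mL.
    by rewrite mL.
  have colK n : \sum_(m in K) conj (u m) * gram phi m n = 0.
    rewrite -[RHS](_ : conj (inner (phi n) 0) = 0); last first.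
      by rewrite /inner linear0l rmorph0.
    rewrite -(sum_simplex_gram_on t_u) /inner linear_sumlz rmorph_sum.
    apply: eq_bigr => m _.
    by rewrite linearZl_LR rmorphM /= -(gram_conj phi n m).
  apply: (mulfI (lt0r_neq0 A_gt0)); rewrite mulr0.
  (* Evaluate u^H G w in both orders: [rowL] gives [A] times the sum of the [a n], [colK] gives
     0. *)
  transitivity (\sum_(m in K) conj (u m) * (\sum_(n in L) w n * gram phi m n)).
    rewrite mulr_sumr (eq_bigl _ _ (fun n => finset.in_setI n K L)) big_mkcondr /=.
    apply: eq_bigr => m _; rewrite rowL; case: (m \in L); last by rewrite mulr0.
    by rewrite mulrCA.
  under eq_bigr do rewrite mulr_sumr.
  rewrite exchange_big big1 // => n _ /=.
  under eq_bigr do rewrite mulrCA.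
  by rewrite -mulr_sumr colK mulr0.
have a_opp m n : m \in K :&: L -> n \in K :&: L -> m != n -> a n = - a m.
  move=> /setIP[mK mL] /setIP[nK nL] m_n.
  have tt' : t = t'.
    rewrite -(simplex_gram_on_norm t_u mK nK m_n).
    rewrite -(simplex_gram_on_norm t_w mL nL m_n).
    by rewrite psiE (negbTE m_n) sub0r normrN.
  have : t * (u m * conj (u n)) = - (t * (w m * conj (w n))).
    have := psiE m n; rewrite psi_gram // phi_gram // (negbTE m_n) -tt'.
    by rewrite !mulr0n !sub0r opprK -!mulrA => <-.
  rewrite -mulrN => /(mulfI (lt0r_neq0 t_gt0)) uw.
  have um := unimodular_mul_conj (u1 _ mK).
  have wn := unimodular_mul_conj (w1 _ nL).
  rewrite /a -[LHS]mul1r -{1}um.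
  transitivity (conj (u m) * (u m * conj (u n)) * w n); first by ring.
  by rewrite uw -[in RHS](mulr1 (w m)) -wn; ring.
(* Three common elements would give [a m = - a m] after three sign changes; a single one would make
   the zero sum [sum_a] a nonzero term. *)
have [] := leqP #|K :&: L| 2; last first.
  move=> /card_gt2P[m [n [l [[mKL nKL lKL] [m_n n_l l_m]]]]].
  have := a_neq0 m mKL; have := a_opp _ _ lKL mKL l_m.
  rewrite (a_opp _ _ nKL lKL n_l) (a_opp _ _ mKL nKL m_n) opprK => /eqP.
  by rewrite -addr_eq0 -mulr2n mulrn_eq0 => /eqP->; rewrite eqxx.
case card_KL: #|K :&: L| => [|[|[|//]]] _; [by left| |by right].
have /cards1P[n KL] : #|K :&: L| == 1%N by rewrite card_KL.
have := a_neq0 n; rewrite KL set11 => /(_ isT).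
by move: sum_a; rewrite KL big_set1 => ->; rewrite eqxx.
Qed.

Theorem theorem3p5 (R : realType) (k : scalar_kind) (V : hilbertSpace R k)
    (N : finType) (phi : N -> V) (N_nonempty : (0 < #|N|)%N)
    (phi_dtetf : dtetf phi) :
  (binder phi = classical_sets.set0 \/ forms_bibd (binder phi)) /\
  (forall (B : finType) (blk : B -> {set N}),
     enumerates blk (binder phi) -> bibd blk ->
     forall (W : hilbertSpace R k) (psi : N -> W), dual phi psi ->
     forall L : {set N}, binder psi L -> oval blk L).
Proof.
split; first exact: dtetf_binder_bibd.
move=> B blk [blk_bin _ _] _ W psi phi_psi L L_bin; split; first by case: L_bin.
by move=> b; apply: binder_dual_inter phi_psi _ L_bin; apply: blk_bin.
Qed.
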